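(* Interval-posets are in bijection with intervals of the Tamari order. More precisely, to each interval-poset corresponds a couple of binary trees $T_1\le T_2$ (in the Tamari order) such that the linear extensions of the interval-poset are exactly the linear extensions of the binary trees $T'\in[T_1,T_2]$. Conversely, interval-posets are the only posets labelled by $\{1,\dots,n\}$ whose set of linear extensions is an interval $[\alpha_{T_1},\omega_{T_2}]$ of the right weak order, with $\alpha_{T_1}$ (resp. $\omega_{T_2}$) the minimal (resp. maximal) permutation of the sylvester class of a binary tree $T_1$ (resp. $T_2$).
   Context: Binary trees are planar: either empty or a root node with an ordered pair (left subtree, right subtree); $x(A,B)$ denotes the tree with root $x$ and left/right subtrees $A,B$; size is the number of nodes. The Tamari order on binary trees of size $n$ is the reflexive transitive closure of right rotation, which replaces a subtree $y(x(A,B),C)$ by $x(A,y(B,C))$ (result greater). A binary tree of size $n$ is identified with its binary search tree labelling: the unique labelling of its nodes by $1,\dots,n$ such that for each node labelled $k$ all labels in its left subtree are smaller than $k$ and all labels in its right subtree are larger than $k$. It is viewed as a poset on $\{1,\dots,n\}$: for $a\ne b$, $a\vartriangleleft_T b$ iff $a$ lies in the subtree rooted at $b$. A linear extension of a poset $(\{1,\dots,n\},\vartriangleleft)$ is a permutation, written as a word, in which $a$ appears before $b$ whenever $a\vartriangleleft b$. The sylvester class of $T$ is the set of linear extensions of $T$; it is an interval of the right weak order, whose minimum and maximum are denoted $\alpha_T$ and $\omega_T$. The sylvester classes of the trees of size $n$ partition $\mathfrak{S}_n$. Right weak order: $\mu\le\sigma$ iff every coinversion of $\mu$ is a coinversion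 of $\sigma$, where a coinversion of $\sigma$ is a pair $(a,b)$ with $a<b$ and $b$ appearing before $a$ in the word $\sigma$. An interval-poset of size $n$ is a poset $P$ on $\{1,\dots,n\}$ (order relation $\vartriangleleft_P$) such that: (1) if $a\vartriangleleft_P c$ and $a<c$, then $b\vartriangleleft_P c$ for all $a<b<c$; (2) if $c\vartriangleleft_P a$ and $a<c$, then $b\vartriangleleft_P a$ for all $a<b<c$. Intervals of the Tamari order of size $n$ correspond to interval-posets of size $n$. *)

(* Defs.v *)
From Stdlib Require Import Relation_Operators.
From mathcomp Require Import all_boot fingroup perm.
From mathcomp Require Import classical_sets functions.

Set Implicit Arguments.
Unset Strict Implicit.
Unset Printing Implicit Defensive.

Inductive bintree : Type :=
| Leaf
| Node of bintree & bintree.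

Fixpoint tree_size (T : bintree) : nat :=
  if T is Node A B then (tree_size A + tree_size B).+1 else 0.

Inductive right_rotation : bintree -> bintree -> Prop :=
| rotation_root A B C :
    right_rotation (Node (Node A B) C) (Node A (Node B C))
| rotation_left A A' B :
    right_rotation A A' -> right_rotation (Node A B) (Node A' B)
| rotation_right A B B' :
    right_rotation B B' -> right_rotation (Node A B) (Node A B').

Definition tamari_le : bintree -> bintree -> Prop :=
  clos_refl_trans bintree right_rotation.

Definition tamari_interval (n : nat) (I : bintree * bintree) : Prop :=
  [/\ tree_size I.1 = n, tree_size I.2 = n & tamari_le I.1 I.2].

(* The labels 1, ..., n are represented by 0, ..., n - 1 throughout, so that
   the label set is ['I_n]. *)

Inductive ltree : Type :=
| LLeaf
| LNode of ltree & nat & ltree.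

Fixpoint ltree_shape (L : ltree) : bintree :=
  if L is LNode A _ B then Node (ltree_shape A) (ltree_shape B) else Leaf.

Fixpoint labels (L : ltree) : seq nat :=
  if L is LNode A x B then labels A ++ x :: labels B else [::].

Fixpoint is_bst (L : ltree) : bool :=
  if L is LNode A x B then
    [&& all (ltn^~ x) (labels A), all (ltn x) (labels B), is_bst A & is_bst B]
  else true.

(* Inorder numbering starting from [k]; by [bst_labelP] below,
   [bst_label 0 T] is the unique binary search tree labelling of [T]. *)
Fixpoint bst_label (k : nat) (T : bintree) : ltree :=
  if T is Node A B then
    LNode (bst_label k A) (k + tree_size A) (bst_label (k + tree_size A).+1 B)
  else LLeaf.

(* [a] lies in the subtree of [L] rooted at [b]. *)
Fixpoint in_subtree (L : ltree) (a b : nat) : bool :=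
  if L is LNode A x B then
    [|| (b == x) && (a \in labels L), in_subtree A a b | in_subtree B a b]
  else false.

Lemma ltree_shape_bst_label k T : ltree_shape (bst_label k T) = T.
Proof. by elim: T k => //= A IHA B IHB k; rewrite IHA IHB. Qed.

Lemma labels_bst_label k T : labels (bst_label k T) = iota k (tree_size T).
Proof.
elim: T k => // A IHA B IHB k.
by rewrite [tree_size _]/= -addnS iotaD /= IHA IHB.
Qed.

Lemma is_bst_sorted L : is_bst L = sorted ltn (labels L).
Proof.
elim: L => //= A IHA x B IHB.
rewrite !(sorted_pairwise ltn_trans) pairwise_cat pairwise_cons allrel_consr.
rewrite -!(sorted_pairwise ltn_trans) -IHA -IHB.
case allA: (all (ltn^~ x) (labels A)) => //=.
case allB: (all (ltn x) (labels B)); last by rewrite /= !andbF.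
rewrite /=; suff -> : allrel ltn (labels A) (labels B) by [].
apply/allrelP => a b /(allP allA) ax /(allP allB) xb.
exact: ltn_trans ax xb.
Qed.

Lemma size_labels L : size (labels L) = tree_size (ltree_shape L).
Proof.
by elim: L => //= A IHA x B IHB; rewrite size_cat /= IHA IHB addnS.
Qed.

Lemma labels_ltree_shape_inj L L' :
  ltree_shape L = ltree_shape L' -> labels L = labels L' -> L = L'.
Proof.
elim: L L' => [|A IHA x B IHB] [|A' x' B'] //= [sA sB] /eqP.
rewrite eqseq_cat ?size_labels ?sA // => /andP[/eqP lA /eqP[-> lB]].
by rewrite (IHA _ sA lA) (IHB _ sB lB).
Qed.

Lemma bst_labelP (T : bintree) (L : ltree) :
  [/\ ltree_shape L = T, perm_eq (labels L) (iota 0 (tree_size T)) & is_bst L]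
  <-> L = bst_label 0 T.
Proof.
split=> [[sL pL bL]|->]; last first.
  split; first exact: ltree_shape_bst_label.
    by rewrite labels_bst_label.
  by rewrite is_bst_sorted labels_bst_label iota_ltn_sorted.
apply: labels_ltree_shape_inj; first by rewrite ltree_shape_bst_label.
rewrite labels_bst_label.
apply: (sorted_eq ltn_trans _ _ (iota_ltn_sorted _ _) pL).
  by move=> x y /andP[/ltn_trans h /h]; rewrite ltnn.
by rewrite -is_bst_sorted.
Qed.

(* A binary relation is given by its graph: [(a, b) \in P] reads a <|_P b.
   Order relations are taken to be reflexive. *)

Definition is_poset n (P : {set 'I_n * 'I_n}) : Prop :=
  [/\ reflexive (fun a b => (a, b) \in P),
      antisymmetric (fun a b => (a, b) \in P) &
      transitive (fun a b => (a, b) \in P)].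

Definition interval_poset n (P : {set 'I_n * 'I_n}) : Prop :=
  [/\ is_poset P,
      forall a b c : 'I_n, a < b -> b < c -> (a, c) \in P -> (b, c) \in P &
      forall a b c : 'I_n, a < b -> b < c -> (c, a) \in P -> (b, a) \in P].

(* Meaningful when [tree_size T = n]. *)
Definition tree_poset n (T : bintree) : {set 'I_n * 'I_n} :=
  [set ab : 'I_n * 'I_n | in_subtree (bst_label 0 T) ab.1 ab.2]%SET.

(* A permutation [s] is the word [s 0, s 1, ..., s (n - 1)], so the position
   of the letter [a] is [s^-1 a]. *)
Definition before n (s : 'S_n) (a b : 'I_n) : bool := (s^-1)%g a < (s^-1)%g b.

Definition linear_extension n (P : {set 'I_n * 'I_n}) (s : 'S_n) : Prop :=
  forall a b : 'I_n, a != b -> (a, b) \in P -> before s a b.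

Definition coinversion n (s : 'S_n) (a b : 'I_n) : bool :=
  (a < b) && before s b a.

Definition weak_le n (s t : 'S_n) : Prop :=
  forall a b : 'I_n, coinversion s a b -> coinversion t a b.

Definition sylvester_class n (T : bintree) (s : 'S_n) : Prop :=
  linear_extension (tree_poset n T) s.

(* [s] is alpha_T. It is unique since [weak_le] is antisymmetric. *)
Definition sylvester_min n (T : bintree) (s : 'S_n) : Prop :=
  sylvester_class T s /\ forall t : 'S_n, sylvester_class T t -> weak_le s t.

(* [s] is omega_T. *)
Definition sylvester_max n (T : bintree) (s : 'S_n) : Prop :=
  sylvester_class T s /\ forall t : 'S_n, sylvester_class T t -> weak_le t s.

(* Main.v *)
Require Import Defs.
From Stdlib Require Import Relation_Operators.
From mathcomp Require Import all_boot fingroup perm zify.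
From mathcomp Require Import boolp classical_sets functions.

(** Split an order [P] on the labels into its increasing half, the relations
[a <| b] with [a < b], and its decreasing half, the relations [b <| a] with
[a < b].  Interval-posets, trees and permutations are all governed by such
halves.

- A rotation enlarges the decreasing half of a tree and shrinks the increasing
  one, and conversely [T <= T'] in the Tamari order as soon as one of the two
  inclusions holds ([tamari_leE], [tamari_le_decr]).  To get the rotations from
  the inclusion of increasing halves, the root of [T'] is brought to the root
  of [T] by right rotations ([tamari_raise]) and one recurses in the two
  subtrees.  That one inclusion gives the other comes from the existence of
  lowest common ancestors whose label lies between those of the two nodes
  ([desc_lca]).

- The linear extensions of an interval-poset [P] are the permutations whose
  coinversions include the decreasing half of [P] and avoid the increasing
  half.  The two axioms of interval-posets make the smallest and the largest
  such sets of coinversions transitive and co-transitive, so they are realized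
  by permutations [alpha] and [omega] ([exists_min_extension],
  [exists_max_extension]), and the linear extensions form the weak interval
  [[alpha, omega]] ([linear_extensionE]).

- Every permutation is a linear extension of some tree, its decreasing tree.
  If a linear extension of [P] is also one of [T], then [P] is contained in the
  poset of [T] ([interval_poset_sub_tree]).  For the trees [T1] of [alpha] and
  [T2] of [omega] this shows that [T1] has the decreasing half of [P] and [T2]
  its increasing half; this is the bijection.  Its inverse glues the decreasing
  half of [T1] to the increasing half of [T2] ([tamari_bounds_surj]).

- If the linear extensions of a poset [P] form an interval
  [[alpha_T1, omega_T2]], then an increasing relation of [P] holds in [omega],
  hence in [T2]; the axiom of interval-posets for [T2] then yields relations
  that hold in [omega], hence in every permutation below it, hence in [P],
  because a finite poset is the intersection of its linear extensions
  ([linear_extension_avoiding]).  Decreasing relations are handled by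
  [alpha_T1]. *)

Set Implicit Arguments.
Unset Strict Implicit.
Unset Printing Implicit Defensive.

(** * The descendant relation of a labelled tree *)

(** The smallest label [k] is kept as a parameter: the right subtree of a tree is
labelled from its root label plus one, so inductions on trees need it. *)
Definition desc (k : nat) (T : bintree) (a b : nat) : bool :=
  in_subtree (bst_label k T) a b.

Lemma desc_node k A B a b :
  desc k (Node A B) a b =
  [|| (b == k + tree_size A) && (k <= a < k + (tree_size A + tree_size B).+1),
      desc k A a b | desc (k + tree_size A).+1 B a b].
Proof.
rewrite /desc /= mem_cat inE !labels_bst_label !mem_iota.
by congr [|| _ && _, _ | _]; lia.
Qed.

Lemma desc_range k T a b :
  desc k T a b ->
  (k <= a < k + tree_size T) /\ (k <= b < k + tree_size T).
Proof.
elim: T k => [|A IHA B IHB] k //; rewrite desc_node /=.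
by case/or3P => [|/IHA|/IHB]; lia.
Qed.

Lemma desc_refl k T a : k <= a < k + tree_size T -> desc k T a a.
Proof.
elim: T k => [|A IHA B IHB] k /=; first by lia.
move=> ka; rewrite desc_node.
have [->|ne] := eqVneq a (k + tree_size A); first by apply/or3P/Or31; lia.
have [lt|ge] := ltnP a (k + tree_size A).
  by apply/or3P/Or32/IHA; lia.
by apply/or3P/Or33/IHB; lia.
Qed.

Lemma desc_trans k T a b c : desc k T a b -> desc k T b c -> desc k T a c.
Proof.
elim: T k => [|A IHA B IHB] k // ab bc.
have [ra _] := desc_range ab; rewrite /= in ra.
move: ab bc; rewrite !desc_node.
case/or3P => ab; case/or3P => bc; try (by apply/or3P/Or31; lia).
- by have := desc_range bc; lia.
- by have := desc_range bc; lia.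
- by apply/or3P/Or32; apply: IHA ab bc.
- by have := desc_range bc; have := desc_range ab; lia.
- by have := desc_range bc; have := desc_range ab; lia.
- by apply/or3P/Or33; apply: IHB ab bc.
Qed.

Lemma desc_anti k T a b : desc k T a b -> desc k T b a -> a = b.
Proof.
elim: T k => [|A IHA B IHB] k //; rewrite !desc_node.
case/or3P => ab; case/or3P => ba;
  try (have Ra := desc_range ab); try (have Rb := desc_range ba);
  [lia..| exact: IHA ab ba | lia | lia | lia | exact: IHB ab ba].
Qed.

(** The labels below a node form an interval around its own label. *)
Lemma desc_convex k T a b c :
  desc k T a c -> (a <= b <= c) || (c <= b <= a) -> desc k T b c.
Proof.
elim: T k => [|A IHA B IHB] k // ac hb.
have [/= ra rc] := desc_range ac.
move: ac; rewrite !desc_node; case/or3P => ac.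
- by apply/or3P/Or31; lia.
- by apply/or3P/Or32; apply: IHA ac hb.
- by apply/or3P/Or33; apply: IHB ac hb.
Qed.

(** The lowest common ancestor of two nodes separates them in inorder, so its
label lies between theirs. *)
Lemma desc_lca k T a b :
  k <= a -> a <= b -> b < k + tree_size T ->
  exists c, [/\ a <= c <= b, desc k T a c & desc k T b c].
Proof.
elim: T k => [|A IHA B IHB] k /= ka ab bk; first by lia.
have [lt|ge] := ltnP b (k + tree_size A).
  have [c [abc ac bc]] := IHA k ka ab lt.
  by exists c; rewrite !desc_node ac bc !orbT.
have [lt|ge'] := ltnP (k + tree_size A) a.
  have [|c [abc ac bc]] := IHB (k + tree_size A).+1 lt ab; first by lia.
  by exists c; rewrite !desc_node ac bc !orbT.
by exists (k + tree_size A); rewrite !desc_node; split; [lia|apply/or3P/Or31; lia|apply/or3P/Or31; lia].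
Qed.

(** * The Tamari order and increasing relations *)

Definition desc_incr_sub k T' T :=
  forall a b, a < b -> desc k T' a b -> desc k T a b.

Lemma right_rotation_size T T' :
  right_rotation T T' -> tree_size T' = tree_size T.
Proof. by elim => /= *; lia. Qed.

Lemma tamari_le_size T T' : tamari_le T T' -> tree_size T' = tree_size T.
Proof.
elim => [x y /right_rotation_size //|//|x y z _ e1 _ e2].
by rewrite e2.
Qed.

Lemma right_rotation_incr T T' k :
  right_rotation T T' -> desc_incr_sub k T' T.
Proof.
move=> r; elim: r k => [A B C|A A' B r IH|A B B' r IH] k a b lt.
- move=> d; have [/= ra rb] := desc_range d.
  move: d; rewrite !desc_node /=.
  have -> : k + (tree_size A + tree_size B).+1 = (k + tree_size A).+1 + tree_size B by lia.
  case/or4P => [h|->|h|/orP[->|->]]; rewrite ?orbT //; first by lia.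
  by apply/or3P/Or31; lia.
- rewrite !desc_node (right_rotation_size r).
  by case/or3P => [->|/(IH _ _ _ lt) ->|->]; rewrite ?orbT.
- rewrite !desc_node (right_rotation_size r).
  by case/or3P => [->|->|/(IH _ _ _ lt) ->]; rewrite ?orbT.
Qed.

Lemma tamari_le_incr T T' k : tamari_le T T' -> desc_incr_sub k T' T.
Proof.
elim => [x y /right_rotation_incr //|x a b //|x y z _ IH1 _ IH2 a b lt d].
by apply: IH1 => //; apply: IH2.
Qed.

Lemma tamari_le_refl T : tamari_le T T.
Proof. exact: rt_refl. Qed.

Lemma tamari_le_trans T U V : tamari_le T U -> tamari_le U V -> tamari_le T V.
Proof. exact: rt_trans. Qed.

Lemma tamari_le_node A A' B B' :
  tamari_le A A' -> tamari_le B B' -> tamari_le (Node A B) (Node A' B').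
Proof.
move=> lA lB; apply: (@tamari_le_trans _ (Node A' B)).
  elim: lA => [x y r|x|x y z _ h1 _ h2].
  - by apply: rt_step; apply: rotation_left.
  - exact: tamari_le_refl.
  - exact: tamari_le_trans h1 h2.
elim: lB => [x y r|x|x y z _ h1 _ h2].
- by apply: rt_step; apply: rotation_right.
- exact: tamari_le_refl.
- exact: tamari_le_trans h1 h2.
Qed.

(** A node [k + m] above all smaller labels lies on the left branch of [T], so
right rotations alone bring it to the root.  They only destroy relations from
a label at most [k + m] to a larger one, hence the increasing relations within
each side survive. *)
Lemma tamari_raise k T m :
  m < tree_size T -> (forall a, k <= a < k + m -> desc k T a (k + m)) ->
  exists A B, [/\ tree_size A = m, tamari_le T (Node A B),
    forall a b, b < k + m -> desc k T a b -> desc k A a b &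
    forall a b, k + m < a -> a < b -> desc k T a b -> desc (k + m).+1 B a b].
Proof.
elim: T m => [|A IHA B _] m //= mT under.
have [lt|gt|eqm] := ltngtP m (tree_size A).
- have [a ha|A1 [B1 [sA1 le1 h1 h2]]] := IHA m lt.
    have := under a ha; rewrite desc_node.
    by case/or3P=> [|//|/desc_range]; lia.
  have sA := tamari_le_size le1; rewrite /= in sA.
  exists A1, (Node B1 B); split=> //.
  + apply: (@tamari_le_trans _ (Node (Node A1 B1) B)).
      by apply: tamari_le_node => //; apply: tamari_le_refl.
    by apply: rt_step; apply: rotation_root.
  + move=> a b bk; rewrite desc_node.
    case/or3P => [|d|/desc_range]; [lia|exact: h1|lia].
  + move=> a b ma ab; rewrite !desc_node => /or3P[d|d|d].
    * by apply/or3P/Or31; lia.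
    * by rewrite h2 ?orbT.
    * apply/or3P/Or33; move: d.
      by congr (desc _ _ _ _); lia.
- have := under (k + tree_size A); rewrite desc_node => h.
  by have /or3P[|/desc_range|/desc_range] : _ := h ltac:(lia); lia.
- exists A, B; split=> //; first exact: tamari_le_refl.
  + move=> a b bk; rewrite desc_node.
    by case/or3P=> [|//|/desc_range]; lia.
  + move=> a b ka ab; rewrite desc_node eqm.
    by case/or3P=> [|/desc_range|//]; lia.
Qed.

(** The root of [T'] is above all smaller labels in [T'], hence in [T]; it can
therefore be raised to the root of [T] without losing the increasing relations
of [T'], none of which crosses its root from left to right. *)
Lemma incr_tamari_le k T T' :
  tree_size T = tree_size T' -> desc_incr_sub k T' T -> tamari_le T T'.
Proof.
elim: T' k T => [|A' IHA B' IHB] k T sT sub.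
  by case: T sT {sub} => // _; apply: tamari_le_refl.
rewrite /= in sT.
have [|a ha|A [B [sA le hA hB]]] := @tamari_raise k T (tree_size A').
- by lia.
- by apply: sub; [lia | rewrite desc_node; apply/or3P/Or31; lia].
have := tamari_le_size le; rewrite /= => sB.
apply: (tamari_le_trans le); apply: tamari_le_node.
- apply: (IHA k) => // a b ab d; have R := desc_range d.
  by apply: hA; [lia | apply: sub ab _; rewrite desc_node d orbT].
- apply: (IHB (k + tree_size A').+1); first by lia.
  move=> a b ab d; have R := desc_range d.
  by apply: hB; [lia | lia| apply: sub ab _; rewrite desc_node d !orbT].
Qed.

(** Otherwise the root of [T] would be a smaller label than the root of [T'],
hence below it in [T'] and then in [T]. *)
Lemma incr_root k A B A' B' :
  tree_size (Node A B) = tree_size (Node A' B') ->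
  desc_incr_sub k (Node A' B') (Node A B) -> tree_size A' <= tree_size A.
Proof.
rewrite /= => sT sub; rewrite leqNgt; apply/negP => lt.
have := sub (k + tree_size A) (k + tree_size A').
rewrite !desc_node => /(_ ltac:(lia) ltac:(lia)).
by case/or3P => [|/desc_range|/desc_range]; lia.
Qed.

Lemma incr_inj k T T' :
  tree_size T = tree_size T' ->
  desc_incr_sub k T' T -> desc_incr_sub k T T' -> T = T'.
Proof.
elim: T k T' => [|A IHA B IHB] k [|A' B'] // sT sub sub'.
have := incr_root sT sub; have := incr_root (esym sT) sub' => le1 le2.
have sA : tree_size A = tree_size A' by lia.
have sB : tree_size B = tree_size B' by rewrite /= in sT; lia.
congr Node.
- apply: (IHA k) => // a b ab d; have R := desc_range d.
    have := sub a b ab; rewrite !desc_node d !orbT => /(_ isT).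
    by case/or3P=> [|//|/desc_range]; lia.
  have := sub' a b ab; rewrite !desc_node d !orbT => /(_ isT).
  by case/or3P=> [|//|/desc_range]; lia.
- apply: (IHB (k + tree_size A).+1) => // a b ab d; have R := desc_range d.
    have := sub a b ab; rewrite !desc_node -sA d !orbT => /(_ isT).
    by case/or3P=> [|/desc_range|//]; lia.
  have := sub' a b ab; rewrite !desc_node -sA d !orbT => /(_ isT).
  by case/or3P=> [|/desc_range|//]; lia.
Qed.

(** The tree is the decreasing tree of the word with value [p x] at [x]: the
maximum is the root, and the factors on its two sides give the subtrees. *)
Lemma decreasing_tree (p : nat -> nat) k m :
  exists2 T, tree_size T = m & forall a b, desc k T a b -> p a <= p b.
Proof.
elim/ltn_ind: m k => -[|m] IH k; first by exists Leaf.
have [i _ imax] := arg_maxnP (fun i : 'I_m.+1 => p (k + i)) (erefl (predT ord0)).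
have im := ltn_ord i.
have [A sA hA] := IH i im k.
have [|B sB hB] := IH (m - i) _ (k + i).+1; first by lia.
exists (Node A B) => [/=|a b]; first by lia.
rewrite desc_node sA sB => /or3P[/andP[/eqP -> ra]|/hA //|/hB //].
have lt : a - k < m.+1 by lia.
by have := imax (Ordinal lt) isT; rewrite /= subnKC //; lia.
Qed.

(** * Permutations from orders and from coinversions *)

Section Orders.

Variable n : nat.
Implicit Types (P Q : {set 'I_n * 'I_n}) (s t : 'S_n) (a b c : 'I_n).

Lemma before_neq s a b : a != b -> before s b a = ~~ before s a b.
Proof.
move=> ab; rewrite /before -leqNgt ltn_neqAle; case: eqP => //= e.
by rewrite (perm_inj (val_inj e)) eqxx in ab.
Qed.

Lemma perm_of_order (R : rel 'I_n) :
  irreflexive R -> transitive R -> (forall a b, a != b -> R a b || R b a) ->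
  exists s, forall a b, before s a b = R a b.
Proof.
move=> irr tr tot.
(* The position of [a] in the word is the number of its predecessors. *)
pose below a := [set x | R x a]%SET.
have mono a b : R a b -> #|below a| < #|below b|.
  move=> Rab; apply: proper_card; apply/properP; split.
    by apply/fintype.subsetP => x; rewrite !inE => /tr; apply.
  by exists a; rewrite !inE ?irr.
have bound a : #|below a| < n.
  rewrite -[X in _ < X]card_ord -cardsT; apply: proper_card.
  by apply/properP; split; [exact: finset.subsetT | exists a; rewrite !inE ?irr].
have inj : injective (fun a => Ordinal (bound a)).
  move=> a b [eqab]; apply/eqP/negPn/negP => /tot /orP[] /mono.
    by rewrite eqab ltnn.
  by rewrite eqab ltnn.
exists (perm inj)^-1%g => a b; rewrite /before invgK !permE /=.
apply/idP/idP => [|/mono //].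
have [->|/tot/orP[//|/mono]] := eqVneq a b; first by rewrite ltnn.
by move=> /ltnW; rewrite leqNgt => /negPf ->.
Qed.

(** Reversing the usual order on the pairs in [C] gives a strict total order
precisely when [C] and its complement are both transitive. *)
Lemma perm_of_coinversions (C : rel 'I_n) :
  (forall a b c, a < b -> b < c -> C a b -> C b c -> C a c) ->
  (forall a b c, a < b -> b < c -> C a c -> C a b || C b c) ->
  exists s, forall a b, coinversion s a b = (a < b) && C a b.
Proof.
move=> tr cotr.
pose R a b := if a < b then ~~ C a b else (b < a) && C b a.
have [||a b|s hs] := @perm_of_order R.
- by move=> a; rewrite /R ltnn.
- rewrite /R => b a c.
  case: (ltngtP a b) => [ab|ba|/val_inj ->] //=.
    case: (ltngtP b c) => [bc|cb|/val_inj <-] //.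
      move=> nab nbc; rewrite (ltn_trans ab bc).
      by apply/negP => /(cotr _ _ _ ab bc); rewrite (negPf nab) (negPf nbc).
    case: (ltngtP a c) => [ac|ca|/val_inj eac] //= nab cb'.
      by apply: contra nab => /(tr _ _ _ ac cb); apply.
      by have := cotr _ _ _ ca ab cb'; rewrite (negPf nab) orbF.
    by rewrite eac cb' in nab.
  case: (ltngtP b c) => [bc|cb|/val_inj <-] //=.
  case: (ltngtP a c) => [ac|ca|/val_inj eac] //= ba' nbc.
  - by apply: contra nbc; apply: tr ba ac ba'.
  - by have := cotr _ _ _ bc ca ba'; rewrite (negPf nbc).
  - by rewrite -eac ba' in nbc.
  move=> ba' cb'; have ca := ltn_trans cb ba.
  by rewrite ltnNge (ltnW ca) ca /=; apply: tr cb' ba'.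
- by rewrite /R -val_eqE; case: (ltngtP a b) => //=; case: (C _ _).
exists s => a b; rewrite /coinversion hs /R.
by case: (ltngtP a b).
Qed.

(** A finite poset is the intersection of its linear extensions: if [a <| b]
fails, then [b <| a] can be added to the order, and the result linearized. *)
Lemma linear_extension_avoiding P a b :
  is_poset P -> (a, b) \notin P ->
  exists2 s, linear_extension P s & before s b a.
Proof.
move=> [refl anti tr] nab.
(* The order generated by [P] and [b <| a]. *)
pose Q x y := ((x, y) \in P) || ((x, b) \in P) && ((a, y) \in P).
have PQ x y : (x, y) \in P -> Q x y by rewrite /Q => ->.
have Qtr : transitive Q.
  move=> y x z; rewrite /Q => /orP[xy|/andP[xb ay]] /orP[yz|/andP[yb az]].
  - by rewrite (tr _ _ _ xy yz).
  - by rewrite (tr _ _ _ xy yb) az orbT.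
  - by rewrite xb (tr _ _ _ ay yz) orbT.
  - by rewrite xb az orbT.
have Qanti x y : Q x y -> Q y x -> x = y.
  rewrite /Q => /orP[xy|/andP[xb ay]] /orP[yx|/andP[yb ax]].
  - by apply: anti; rewrite xy yx.
  - by case/negP: nab; apply: tr ax (tr _ _ _ xy yb).
  - by case/negP: nab; apply: tr ay (tr _ _ _ yx xb).
  - by case/negP: nab; apply: tr ax xb.
(* Sorting by the size of the down-set, ties broken by label, extends [Q]. *)
pose h x := #|[set y | Q y x]%SET|.
have hlt x y : x != y -> Q x y -> h x < h y.
  move=> xy Qxy; apply: proper_card; apply/properP; split.
    by apply/fintype.subsetP => z; rewrite !inE => /Qtr; apply.
  exists y; rewrite !inE; first exact/PQ/refl.
  by apply: contra xy => /(Qanti _ _ Qxy) ->.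
have [x|y x z|x y|s hs] := @perm_of_order (fun x y => (h x < h y) || (h x == h y) && (x < y)).
- by rewrite /= !ltnn andbF.
- by rewrite /=; lia.
- by rewrite -val_eqE /=; lia.
exists s => [x y xy /PQ Qxy|]; first by rewrite hs hlt.
rewrite hs hlt //; last by rewrite /Q !refl orbT.
by apply: contra nab => /eqP ->; apply: refl.
Qed.

(** * Linear extensions of interval-posets *)

(** A linear extension of [P] must have the coinversions listed in
[is_min_extension], and only those listed in [is_max_extension] are possible;
for interval-posets both extremes are attained. *)
Definition is_min_extension P s :=
  forall a b, coinversion s a b = (a < b) && ((b, a) \in P).
Definition is_max_extension P s :=
  forall a b, coinversion s a b = (a < b) && ((a, b) \notin P).

Lemma exists_min_extension P :
  interval_poset P -> exists s, is_min_extension P s.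
Proof.
move=> [[_ _ tr] _ dec].
apply: (@perm_of_coinversions (fun a b => (b, a) \in P)) => a b c ab bc.
  by move=> ba cb; apply: tr cb ba.
by move=> ca; rewrite (dec _ _ _ ab bc ca).
Qed.

Lemma exists_max_extension P :
  interval_poset P -> exists s, is_max_extension P s.
Proof.
move=> [[_ _ tr] inc _].
apply: (@perm_of_coinversions (fun a b => (a, b) \notin P)) => a b c ab bc.
  by move=> _; apply: contra => /(inc _ _ _ ab bc).
rewrite -negb_and; apply: contra => /andP[h1 h2].
exact: tr h1 h2.
Qed.

(** Being above [al] expresses the decreasing relations of [P], and being below
[om] the increasing ones. *)
Lemma linear_extensionE P s al om :
  is_min_extension P al -> is_max_extension P om ->
  linear_extension P s <-> weak_le al s /\ weak_le s om.
Proof.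
move=> hal hom; split=> [ext|[ge le] a b ab Pab].
  split=> a b.
    rewrite hal /coinversion => /andP[ab ba]; rewrite ab /=.
    by apply: ext => //; rewrite -val_eqE /= gtn_eqF.
  rewrite hom /coinversion => /andP[ab ba]; rewrite ab /=.
  have nab : a != b by rewrite -val_eqE /= ltn_eqF.
  by apply/negP => /(ext _ _ nab); rewrite -[before _ _ _]negbK -before_neq ?ba.
case: (ltngtP a b) => [lt|gt|/val_inj e]; last by rewrite e eqxx in ab.
  rewrite -[before _ _ _]negbK -before_neq //; apply/negP => ba.
  by have := le a b; rewrite hom /coinversion lt ba Pab /= => /(_ isT).
by have := ge b a; rewrite hal /coinversion gt Pab /= => /(_ isT).
Qed.

Lemma min_extension_linear P s :
  interval_poset P -> is_min_extension P s -> linear_extension P s.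
Proof.
move=> IP hs; have [om hom] := exists_max_extension IP.
have [[_ anti _] _ _] := IP.
apply/(linear_extensionE _ hs hom).
split=> // a b; rewrite hs hom => /andP[ab ba]; rewrite ab.
apply/negP => ba'; have e : a = b by apply: anti; rewrite ba ba'.
by rewrite e ltnn in ab.
Qed.

Lemma max_extension_linear P s :
  interval_poset P -> is_max_extension P s -> linear_extension P s.
Proof.
move=> IP hs; have [al hal] := exists_min_extension IP.
have [[_ anti _] _ _] := IP.
apply/(linear_extensionE _ hal hs).
split=> // a b; rewrite hs hal => /andP[ab ba]; rewrite ab.
apply/negP => ba'; have e : a = b by apply: anti; rewrite ba ba'.
by rewrite e ltnn in ab.
Qed.

End Orders.

(** * Tree posets as interval-posets *)

Section Trees.

Variable n : nat.
Implicit Types (P Q : {set 'I_n * 'I_n}) (s t : 'S_n) (a b c : 'I_n).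
Implicit Types (T : bintree).

Lemma tree_posetE T a b : ((a, b) \in tree_poset n T) = desc 0 T a b.
Proof. by rewrite inE. Qed.

Lemma tree_poset_convex T a b c :
  (a, c) \in tree_poset n T -> (a <= b <= c) || (c <= b <= a) ->
  (b, c) \in tree_poset n T.
Proof. by rewrite !tree_posetE; apply: desc_convex. Qed.

Lemma tree_interval_poset T : tree_size T = n -> interval_poset (tree_poset n T).
Proof.
move=> sT; split; [split|..].
- by move=> a; rewrite tree_posetE desc_refl // sT /=.
- by move=> a b /andP[]; rewrite !tree_posetE => ab /(desc_anti ab)/val_inj.
- by move=> b a c; rewrite !tree_posetE; apply: desc_trans.
- by move=> a b c ab bc /tree_poset_convex; apply; lia.
- by move=> a b c ab bc /tree_poset_convex; apply; lia.
Qed.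

Lemma tree_poset_lca T a b : tree_size T = n -> a <= b ->
  exists c, [/\ a <= c <= b, (a, c) \in tree_poset n T &
                (b, c) \in tree_poset n T].
Proof.
move=> sT ab; have bT : b < 0 + tree_size T by rewrite sT ltn_ord.
have [c [abc ac bc]] := desc_lca (leq0n a) ab bT.
have cn : c < n by have := ltn_ord b; lia.
by exists (Ordinal cn); rewrite !tree_posetE.
Qed.

Lemma exists_sylvester_class s :
  exists2 T, tree_size T = n & linear_extension (tree_poset n T) s.
Proof.
pose p x := if insub x is Some i then val ((s^-1)%g i) else 0.
have [T sT hT] := decreasing_tree p 0 n.
exists T => // a b ab; rewrite tree_posetE => /hT.
rewrite /p !valK /before ltn_neqAle => -> /=; rewrite andbT.
by apply: contra ab => /eqP e; rewrite (perm_inj (val_inj e)).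
Qed.

(** Let [a <| b] in [P] and let [c] be the lowest common ancestor of [a] and [b]
in [T].  Since [c] lies between them, the axioms give [c <| b] in [P]; but
[b <| c] in [T], and both relations hold in [s], so [c = b]. *)
Lemma interval_poset_sub_tree P T s :
  interval_poset P -> tree_size T = n ->
  linear_extension P s -> linear_extension (tree_poset n T) s ->
  P \subset tree_poset n T.
Proof.
move=> [[Pr _ _] inc dec] sT extP extT; apply/fintype.subsetP => -[a b] Pab.
have [c [cab ac bc]] : exists c,
    [/\ (a <= c <= b) || (b <= c <= a), (a, c) \in tree_poset n T
      & (b, c) \in tree_poset n T].
  case/orP: (leq_total a b) => ab; have [c [h1 h2 h3]] := tree_poset_lca sT ab.
    by exists c; rewrite h1.
  by exists c; rewrite h1 orbT.
have [<- //|ncb] := eqVneq c b.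
have Pcb : (c, b) \in P.
  have [<- //|nac] := eqVneq a c.
  move: ncb nac; rewrite -!val_eqE /= => ncb nac.
  case/orP: cab => h; first by apply: inc Pab; lia.
  by apply: dec Pab; lia.
have := extT b c; rewrite eq_sym before_neq // extP //.
by move=> /(_ ncb bc).
Qed.

(** * The Tamari order through either half *)

Definition sub_decr P Q := forall a b, a < b -> (b, a) \in P -> (b, a) \in Q.
Definition sub_incr P Q := forall a b, a < b -> (a, b) \in P -> (a, b) \in Q.

(** Let [b <| a] in [P], with [a < b], and let [c] be the lowest common ancestor
of [a] and [b] in [T].  Then [a <| c] in [T], hence in [P], while [c <| a] in
[P] by the axioms; so [c = a], which means [b <| a] in [T]. *)
Lemma sub_incr_decr P T : interval_poset P -> tree_size T = n ->
  sub_incr (tree_poset n T) P -> sub_decr P (tree_poset n T).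
Proof.
move=> [[Pr anti _] _ dec] sT sub a b ab Pba.
have [c [/andP[ac cb] Tac Tbc]] := tree_poset_lca sT (ltnW ab).
have [<- //|nac] := eqVneq c a.
rewrite -val_eqE /= in nac.
have Pac : (a, c) \in P by apply: sub => //; lia.
have Pca : (c, a) \in P.
  have [-> //|ncb] := eqVneq c b; rewrite -val_eqE /= in ncb.
  by apply: dec Pba; lia.
by have := anti a c; rewrite Pac Pca => /(_ isT) e; rewrite e eqxx in nac.
Qed.

Lemma sub_decr_incr P T : interval_poset P -> tree_size T = n ->
  sub_decr (tree_poset n T) P -> sub_incr P (tree_poset n T).
Proof.
move=> [[Pr anti _] inc _] sT sub a b ab Pab.
have [c [/andP[ac cb] Tac Tbc]] := tree_poset_lca sT (ltnW ab).
have [<- //|ncb] := eqVneq c b.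
rewrite -val_eqE /= in ncb.
have Pbc : (b, c) \in P by apply: sub => //; lia.
have Pcb : (c, b) \in P.
  have [-> //|nac] := eqVneq c a; rewrite -val_eqE /= in nac.
  by apply: inc Pab; lia.
by have := anti b c; rewrite Pbc Pcb => /(_ isT) e; rewrite e eqxx in ncb.
Qed.

Lemma desc_incr_subE T T' : tree_size T' = n ->
  sub_incr (tree_poset n T') (tree_poset n T) -> desc_incr_sub 0 T' T.
Proof.
move=> sT sub a b ab d; have [ra rb] := desc_range d; rewrite sT in ra rb.
by have := sub (Ordinal ra) (Ordinal rb); rewrite !tree_posetE; apply.
Qed.

Lemma tamari_leE T T' : tree_size T = n -> tree_size T' = n ->
  tamari_le T T' <-> sub_incr (tree_poset n T') (tree_poset n T).
Proof.
move=> sT sT'; split=> [/(@tamari_le_incr _ _ 0) sub a b ab|sub].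
  by rewrite !tree_posetE; apply: sub.
by apply: (@incr_tamari_le 0); [rewrite sT | apply: desc_incr_subE].
Qed.

Lemma tamari_le_decr T T' : tree_size T = n -> tree_size T' = n ->
  tamari_le T T' <-> sub_decr (tree_poset n T) (tree_poset n T').
Proof.
move=> sT sT'; split=> [/(tamari_leE sT sT')|] sub.
  by apply: sub_incr_decr => //; apply: tree_interval_poset.
by apply/(tamari_leE sT sT'); apply: sub_decr_incr => //; apply: tree_interval_poset.
Qed.

Lemma tree_eq_incr T T' : tree_size T = n -> tree_size T' = n ->
  sub_incr (tree_poset n T) (tree_poset n T') ->
  sub_incr (tree_poset n T') (tree_poset n T) -> T = T'.
Proof.
by move=> sT sT' h h'; apply: (@incr_inj 0); [rewrite sT| apply: desc_incr_subE..].
Qed.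

(** * The bijection *)

(** The graph of the bijection: the lower tree carries the decreasing relations
of [P], the upper tree the increasing ones. *)
Definition tamari_bounds P (I : bintree * bintree) : Prop :=
  [/\ tree_size I.1 = n, tree_size I.2 = n,
      forall a b, a < b -> ((b, a) \in P) = ((b, a) \in tree_poset n I.1) &
      forall a b, a < b -> ((a, b) \in P) = ((a, b) \in tree_poset n I.2)].

(** The sylvester classes of the least and of the greatest linear extension of
[P] give the two trees.  Both trees contain [P]; conversely a decreasing
relation of the lower tree is a coinversion of the least extension, and dually
for the upper tree. *)
Lemma tamari_bounds_exist P : interval_poset P -> exists I, tamari_bounds P I.
Proof.
move=> IP.
have [al hal] := exists_min_extension IP; have [om hom] := exists_max_extension IP.
have Pal := min_extension_linear IP hal; have Pom := max_extension_linear IP hom.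
have [T1 s1 e1] := exists_sylvester_class al.
have [T2 s2 e2] := exists_sylvester_class om.
have sub1 := interval_poset_sub_tree IP s1 Pal e1.
have sub2 := interval_poset_sub_tree IP s2 Pom e2.
exists (T1, T2); split=> //= a b ab; apply/idP/idP.
- exact: (fintype.subsetP sub1).
- move=> /e1; rewrite -val_eqE /= gtn_eqF // => /(_ isT) ba.
  by have := hal a b; rewrite /coinversion ab ba.
- exact: (fintype.subsetP sub2).
- have nab : a != b by rewrite -val_eqE /= ltn_eqF.
  move=> /(e2 _ _ nab) ab'.
  have := hom a b; rewrite /coinversion ab before_neq // ab' /=.
  by move=> /esym/negbFE.
Qed.

Lemma tamari_bounds_tamari P I : interval_poset P -> tamari_bounds P I -> tamari_interval n I.
Proof.
move=> IP [s1 s2 d1 d2]; split=> //; apply/(tamari_le_decr s1 s2).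
have sub : sub_decr P (tree_poset n I.2).
  by apply: sub_incr_decr => // a b ab; rewrite d2.
by move=> a b ab; rewrite -d1 //; apply: sub.
Qed.

Lemma tamari_bounds_uniq P I J : tamari_bounds P I -> tamari_bounds P J -> I = J.
Proof.
case: I J => [T1 T2] [U1 U2] [/= s1 s2 d1 d2] [/= t1 t2 e1 e2].
congr pair; apply: tree_eq_incr => //.
- apply: sub_decr_incr; rewrite ?tree_interval_poset //.
    exact: tree_interval_poset.
  by move=> a b ab; rewrite -d1 // -e1.
- apply: sub_decr_incr => //; first exact: tree_interval_poset.
  by move=> a b ab; rewrite -d1 // -e1.
- by move=> a b ab; rewrite -d2 // -e2.
- by move=> a b ab; rewrite -d2 // -e2.
Qed.

Lemma tamari_bounds_inj P Q I : interval_poset P -> interval_poset Q ->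
  tamari_bounds P I -> tamari_bounds Q I -> P = Q.
Proof.
move=> [[Pr _ _] _ _] [[Qr _ _] _ _] [_ _ d1 d2] [_ _ e1 e2].
apply/setP => -[a b]; case: (ltngtP a b) => [lt|gt|/val_inj ->].
- by rewrite d2 // e2.
- by rewrite d1 // e1.
- by rewrite Pr Qr.
Qed.

(** As [T1 <= T2], both halves used here are contained in [T1], so antisymmetry
and the decreasing consequences of transitivity are inherited from [T1].  For
[a <| b <| c] with [a < c], transitivity of [T2] applies when [a < b < c]; when
[b < a] the axiom for [b <| c] gives [a <| c]; and [c < b] is impossible, since
the axiom for [a <| b] gives [c <| b], against [b <| c]. *)
Lemma tamari_bounds_surj I : tamari_interval n I ->
  exists2 P, interval_poset P & tamari_bounds P I.
Proof.
case: I => T1 T2 [/= s1 s2 le].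
have incr := (tamari_leE s1 s2).1 le.
have [[r1 anti1 tr1] _ dec] := tree_interval_poset s1.
have [[r2 _ tr2] inc _] := tree_interval_poset s2.
pose P := [set ab : 'I_n * 'I_n | if ab.1 < ab.2 then ab \in tree_poset n T2
                                  else ab \in tree_poset n T1]%SET.
have PE a b : ((a, b) \in P) = if a < b then (a, b) \in tree_poset n T2
                               else (a, b) \in tree_poset n T1 by rewrite inE.
have PT1 a b : (a, b) \in P -> (a, b) \in tree_poset n T1.
  by rewrite PE; case: ltnP => // ab; apply: incr.
have P12 a b : a < b -> ((a, b) \in P) = ((a, b) \in tree_poset n T2).
  by rewrite PE => ->.
have P21 a b : b <= a -> ((a, b) \in P) = ((a, b) \in tree_poset n T1).
  by rewrite PE leqNgt => /negPf ->.
have anti a b : (a, b) \in P -> (b, a) \in P -> a = b.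
  by move=> /PT1 ab /PT1 ba; apply: anti1; rewrite ab ba.
have incP a b c : a < b -> b < c -> (a, c) \in P -> (b, c) \in P.
  by move=> ab bc; rewrite !P12 ?(ltn_trans ab bc) //; apply: inc.
have decP a b c : a < b -> b < c -> (c, a) \in P -> (b, a) \in P.
  move=> ab bc; rewrite !P21 ?(ltnW ab) ?(ltnW (ltn_trans ab bc)) //.
  exact: dec.
have trP : transitive (fun a b => (a, b) \in P).
  move=> b a c ab bc.
  have [eac|nac] := eqVneq a c; first by rewrite P21 ?eac ?r1.
  have T1ac := tr1 _ _ _ (PT1 _ _ ab) (PT1 _ _ bc).
  case: (ltnP a c) => [ac|ca]; last by rewrite P21.
  case: (ltngtP a b) => [lab|lba|/val_inj ->] //; last first.
    by apply: incP bc.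
  case: (ltngtP b c) => [lbc|lcb|/val_inj <-] //.
    by rewrite P12 //; apply: tr2 (_ : (a, b) \in _) _; rewrite -P12.
  have cb := incP _ _ _ ac lcb ab.
  by rewrite (anti _ _ bc cb) ltnn in lcb.
exists P; first by split=> //; split=> // [a|a b /andP[]]; [rewrite P21|exact: anti].
by split=> //= a b ab; rewrite ?(P12 _ _ ab) // P21 // ltnW.
Qed.

(** A linear extension of [P] lies in the sylvester class of a tree containing
[P]; its two halves then compare with those of [T1] and [T2], which are the
halves of [P]. *)
Lemma tamari_bounds_linear_extension P I s : interval_poset P -> tamari_bounds P I ->
  linear_extension P s <->
  exists T, [/\ tamari_le I.1 T, tamari_le T I.2 &
                linear_extension (tree_poset n T) s].
Proof.
case: I => T1 T2 IP [/= s1 s2 d1 d2]; split=> [ext|[T [le1 le2 ext]]].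
  have [T sT extT] := exists_sylvester_class s.
  have sub := interval_poset_sub_tree IP sT ext extT.
  exists T; split=> //.
    apply/(tamari_le_decr s1 sT) => a b ab; rewrite -d1 //.
    exact: (fintype.subsetP sub).
  apply/(tamari_leE sT s2) => a b ab; rewrite -d2 //.
  exact: (fintype.subsetP sub).
have sT : tree_size T = n by rewrite (tamari_le_size le1).
move=> a b ab Pab; apply: ext => //.
case: (ltngtP a b) => [lt|gt|/val_inj e]; last by rewrite e eqxx in ab.
  by apply: (tamari_leE sT s2).1 => //; rewrite -d2.
by apply: (tamari_le_decr s1 sT).1 => //; rewrite -d1.
Qed.

(** * Weak order intervals *)

Lemma sylvester_minE T s : tree_size T = n ->
  sylvester_min T s <-> is_min_extension (tree_poset n T) s.
Proof.
move=> sT; have IT := tree_interval_poset sT.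
have [al hal] := exists_min_extension IT.
have [om hom] := exists_max_extension IT.
have extE t := linear_extensionE t hal hom.
split=> [[/extE[ge _] least] a b|hs].
  rewrite -hal; apply/idP/idP => [|/ge //].
  exact: (least _ (min_extension_linear IT hal)).
split=> [|t]; first exact: min_extension_linear.
by case/(linear_extensionE t hs hom).
Qed.

Lemma sylvester_maxE T s : tree_size T = n ->
  sylvester_max T s <-> is_max_extension (tree_poset n T) s.
Proof.
move=> sT; have IT := tree_interval_poset sT.
have [al hal] := exists_min_extension IT.
have [om hom] := exists_max_extension IT.
have extE t := linear_extensionE t hal hom.
split=> [[/extE[_ le] greatest] a b|hs].
  rewrite -hom; apply/idP/idP => [/le //|].
  exact: (greatest _ (max_extension_linear IT hom)).
split=> [|t]; first exact: max_extension_linear.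
by case/(linear_extensionE t hal hs).
Qed.

Lemma interval_poset_weak_interval P : interval_poset P ->
  exists T1 T2 alpha omega,
    [/\ tree_size T1 = n /\ tree_size T2 = n,
        sylvester_min T1 alpha, sylvester_max T2 omega &
        forall s, linear_extension P s <-> weak_le alpha s /\ weak_le s omega].
Proof.
move=> IP; have [[T1 T2] [/= s1 s2 d1 d2]] := tamari_bounds_exist IP.
have [al hal] := exists_min_extension IP.
have [om hom] := exists_max_extension IP.
exists T1, T2, al, om; split=> //.
- apply/(sylvester_minE _ s1) => a b; rewrite hal.
  by case: ltnP => // ab; rewrite d1.
- apply/(sylvester_maxE _ s2) => a b; rewrite hom.
  by case: ltnP => // ab; rewrite d2.
- by move=> s; apply: linear_extensionE.
Qed.

(** Each relation of [P] passes to [omega] or [alpha], then to the tree, where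
the axiom applies; the new relation then holds throughout the interval. *)
Lemma weak_interval_interval_poset P T1 T2 alpha omega : is_poset P ->
  tree_size T1 = n -> tree_size T2 = n ->
  sylvester_min T1 alpha -> sylvester_max T2 omega ->
  (forall s, linear_extension P s <-> weak_le alpha s /\ weak_le s omega) ->
  interval_poset P.
Proof.
move=> PP s1 s2 /(sylvester_minE _ s1) hal /(sylvester_maxE _ s2) hom extP.
have [_ _ dec] := tree_interval_poset s1.
have [_ inc _] := tree_interval_poset s2.
have [Pr anti _] := PP.
(* The interval is nonempty, so it contains its two bounds. *)
have [s0 /extP[al_s0 s0_om] _] : exists2 s, linear_extension P s & True.
  case: (pselect (exists ab, ab \notin P)) => [[[a b] nab]|all].
    by have [s] := linear_extension_avoiding PP nab; exists s.
  exists 1%g => // a b ab; case/eqP: ab; apply: anti.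
  by apply/andP; split; apply/negPn/negP => h; apply: all; [exists (a, b)|exists (b, a)].
have ext_al : linear_extension P alpha.
  by apply/extP; split=> // a b /al_s0/s0_om.
have ext_om : linear_extension P omega.
  by apply/extP; split=> // a b /al_s0/s0_om.
have mem a b : a != b -> (forall s, linear_extension P s -> before s a b) ->
    (a, b) \in P.
  move=> ab all; apply/negPn/negP => nab.
  have [s /all] := linear_extension_avoiding PP nab.
  by rewrite [before s b a]before_neq // => ->.
split=> // a b c ab bc Pac.
- have T2ac : (a, c) \in tree_poset n T2.
    have := hom a c; rewrite /coinversion (ltn_trans ab bc) /=.
    rewrite before_neq ?ext_om // -?val_eqE /= ?ltn_eqF ?(ltn_trans ab bc) //.
    by move=> /esym/negbFE.
  have nbc : b != c by rewrite -val_eqE /= ltn_eqF.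
  apply: mem => // s /extP[_ le]; rewrite -[before _ _ _]negbK -before_neq //.
  apply/negP => cb; have := le b c; rewrite hom /coinversion bc cb /=.
  by rewrite (inc _ _ _ ab bc T2ac) => /(_ isT).
- have T1ca : (c, a) \in tree_poset n T1.
    have := hal a c; rewrite /coinversion (ltn_trans ab bc) /=.
    by rewrite ext_al // -val_eqE /= gtn_eqF // (ltn_trans ab bc).
  apply: mem => [|s /extP[ge _]]; first by rewrite -val_eqE /= gtn_eqF.
  have := ge a b; rewrite hal /coinversion ab (dec _ _ _ ab bc T1ca).
  by apply.
Qed.

End Trees.

Theorem theorem2p8 (n : nat) :
  (exists f : {set 'I_n * 'I_n} -> bintree * bintree,
     set_bij [set P | interval_poset P]%classic
             [set I | tamari_interval n I]%classic f /\
     (forall P : {set 'I_n * 'I_n}, interval_poset P ->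
        forall s : 'S_n,
          linear_extension P s <->
          exists T : bintree,
            [/\ tamari_le (f P).1 T, tamari_le T (f P).2 &
                linear_extension (tree_poset n T) s])) /\
  (forall P : {set 'I_n * 'I_n}, is_poset P ->
     (interval_poset P <->
      exists (T1 T2 : bintree) (alpha omega : 'S_n),
        [/\ tree_size T1 = n /\ tree_size T2 = n,
            sylvester_min T1 alpha,
            sylvester_max T2 omega &
            forall s : 'S_n,
              linear_extension P s <-> weak_le alpha s /\ weak_le s omega])).
Proof.
split; last first.
  move=> P PP; split; first exact: interval_poset_weak_interval.
  case=> [T1 [T2 [al [om [[s1 s2] hal hom ext]]]]].
  exact: weak_interval_interval_poset PP s1 s2 hal hom ext.
have [P|f hf] := choice (P := fun (P : {set 'I_n * 'I_n}) I =>
                                interval_poset P -> tamari_bounds P I).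
  have [/tamari_bounds_exist[I hI]|nI] := pselect (interval_poset P).
    by exists I.
  by exists (Leaf, Leaf).
exists f; split; last by move=> P IP s; apply: tamari_bounds_linear_extension (hf P IP).
split=> [P IP|P Q /set_mem IP /set_mem IQ e|I hI].
- exact: tamari_bounds_tamari (hf P IP).
- by apply: tamari_bounds_inj (hf P IP) _ => //; rewrite e; apply: hf.
- have [P IP PI] := tamari_bounds_surj hI.
  by exists P => //; apply: tamari_bounds_uniq (hf P IP) PI.
Qed.
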